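(* Let $q$ be a prime power and let $T=\{n_1,n_2,\dots,n_k\}$ be a set of positive integers with $k\ge 1$ and $n_1<n_2<\dots<n_k$. Then there exists a $T$-partition of $V_{2n_k}(q)$.
   Context: $V_n(q)$ denotes the $n$-dimensional vector space over the finite field $\mathbb{F}_q$ with $q$ elements. A partition of $V_n(q)$ is a (finite) set $\mathbf{P}=\{V_1,\dots,V_r\}$ of non-zero subspaces (called components) of $V_n(q)$ such that $\bigcup_{i=1}^r V_i=V_n(q)$ and $V_i\cap V_j=\{0\}$ for $i\neq j$. For a set $T$ of positive integers, a $T$-partition is a partition $\mathbf{P}$ such that $\{\dim V' : V'\in\mathbf{P}\}=T$ (every component has dimension in $T$, and every element of $T$ is the dimension of some component). *)

(* Defs.v *)
From mathcomp Require Import all_boot all_order all_algebra all_field.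

Set Implicit Arguments.
Unset Strict Implicit.
Unset Printing Implicit Defensive.

Import GRing.Theory.

Definition prime_power (q : nat) : Prop :=
  exists p e : nat, [/\ prime p, 0 < e & q = p ^ e].

(* Finite sets of subspaces are represented by duplicate-free sequences. *)
Definition vspace_partition (F : finFieldType) (V : vectType F)
    (P : seq {vspace V}) : Prop :=
  [/\ uniq P,
      (forall U : {vspace V}, U \in P -> U <> 0%VS),
      (forall v : V, exists2 U : {vspace V}, U \in P & v \in U) &
      (forall U W : {vspace V}, U \in P -> W \in P -> U <> W ->
         (U :&: W)%VS = 0%VS)].

(* [=i] compares only the underlying sets: the order and repetitions of the
   dimensions are irrelevant. *)
Definition T_partition (F : finFieldType) (V : vectType F)
    (T : seq nat) (P : seq {vspace V}) : Prop :=
  vspace_partition P /\ [seq \dim U | U <- P] =i T.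

(* Main.v *)
Require Import Defs.
From HB Require Import structures.
From mathcomp Require Import all_boot all_order all_algebra all_field.
From mathcomp Require Import all_fingroup all_solvable.
From Corelib Require Import Setoid.

(** Let n be the largest element of T, let L be the extension of F of degree n
    and q = #|F|; all spaces of dimension 2n being isomorphic, take V = L * L.
    The L-lines of V form a spread of n-dimensional F-subspaces, some of which
    will be recut into smaller pieces.

    The pairing b u c = (c u, c u^q) is F-bilinear, and the vectors b u c lie on
    the L-lines spanned by the (u, u^q).  A nonzero value b u c determines u and
    c up to replacing them by k u and c / k with k in F: the ratio r = u' / u
    of two candidates satisfies r^q = r, hence lies in F
    ([frobenius_segre]).  The values of b thus behave like the tensors of rank
    one in L (x) L: modulo scalars they form a grid PG(L) x PG(L), in which
    both the rows b u B (u fixed, c in a subspace B) and the columns b A c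
    (c fixed, u in a subspace A) are subspaces of V.

    The grid can be cut into rows and columns of any prescribed decreasing
    sequence of sizes n > d1 > d2 > ... ([rectangle_tiling]).  Choose A1 of
    dimension d1 in L and keep the full rows for u outside A1, which have
    dimension n.  The rectangle A1 x L that is left could be cut into its
    columns, of dimension d1.  Choose instead C of dimension d2 in L, keep the
    columns for c outside C, and start again with the rectangle A1 x C.  The
    two sides shrink in turn, and the strict decrease leaves at least one piece
    of each dimension.

    The set of values of b is stable under L, so what it misses is a union of
    L-lines, which are added as further components of dimension n
    ([square_tiling]). *)

Set Implicit Arguments.
Unset Strict Implicit.
Unset Printing Implicit Defensive.

Import GRing.Theory.
Local Open Scope ring_scope.

(** * Tilings of a set of vectors by subspaces *)

(** Repetitions in [P] are harmless here, so that families can be listed by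
    running over vectors that span them; they are removed only at the end. *)
Definition tiles (F : fieldType) (V : vectType F) (S : V -> Prop)
    (P : seq {vspace V}) : Prop :=
  [/\ {in P, forall U, U != 0%VS},
      forall v, S v <-> exists2 U, U \in P & v \in U &
      forall v U W, v != 0 -> U \in P -> W \in P ->
        v \in U -> v \in W -> U = W].

Lemma tiles_cat (F : fieldType) (V : vectType F) (S1 S2 S : V -> Prop)
    (P1 P2 : seq {vspace V}) :
  tiles S1 P1 -> tiles S2 P2 -> (forall v, S v <-> S1 v \/ S2 v) ->
  (forall v, S1 v -> S2 v -> v = 0) -> tiles S (P1 ++ P2).
Proof.
move=> [nz1 cov1 dis1] [nz2 cov2 dis2] defS S12; split.
- by move=> U; rewrite mem_cat => /orP[/nz1|/nz2].
- move=> v; rewrite defS cov1 cov2; split.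
    by case=> [] [U PU Uv]; exists U; rewrite // mem_cat PU ?orbT.
  by case=> U; rewrite mem_cat => /orP[] PU Uv; [left | right]; exists U.
move=> v U W nzv; rewrite !mem_cat => /orP[]PU /orP[]PW Uv Wv.
- exact: dis1 nzv PU PW Uv Wv.
- case/eqP: nzv; apply: S12; first by rewrite cov1; exists U.
  by rewrite cov2; exists W.
- case/eqP: nzv; apply: S12; first by rewrite cov1; exists W.
  by rewrite cov2; exists U.
- exact: dis2 nzv PU PW Uv Wv.
Qed.

Lemma tiles_undup (F : finFieldType) (V : vectType F) (P : seq {vspace V}) :
  tiles (fun=> True) P -> vspace_partition (undup P).
Proof.
move=> [nz cov dis]; split; first exact: undup_uniq.
- by move=> U; rewrite mem_undup => /nz/eqP.
- move=> v; have [/(_ I)[U PU Uv] _] := cov v.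
  by exists U; rewrite ?mem_undup.
move=> U W; rewrite !mem_undup => PU PW neqUW; apply/eqP.
rewrite -subv0; apply/subvP=> v; rewrite memv_cap memv0 => /andP[Uv Wv].
by apply: contra_notT neqUW => nzv; apply: dis nzv PU PW Uv Wv.
Qed.

(** * Rank-one grids *)

Section Segre.

Variable F : finFieldType.

(** The defining property of the Segre map (x, y) |-> x (x) y: modulo scalars,
    a nonzero value determines its two arguments.  Taking x' = 0 or y' = 0, it
    also says that b x y vanishes only if x or y does. *)
Definition segre (X Y V : vectType F) (b : 'Hom(X, 'Hom(Y, V))) : Prop :=
  forall x y x' y', b x y = b x' y' -> x != 0 -> y != 0 ->
    exists2 c, x' = c *: x & y = c *: y'.

Definition rectangle (X Y V : vectType F) (b : 'Hom(X, 'Hom(Y, V)))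
    (A : {vspace X}) (B : {vspace Y}) (v : V) : Prop :=
  exists x y, [/\ x \in A, y \in B & v = b x y].

Lemma bilinear_lfun (X Y V : vectType F) (f : X -> Y -> V) :
  (forall x, linear (f x)) -> (forall y, linear (f^~ y)) ->
  exists b : 'Hom(X, 'Hom(Y, V)), forall x y, b x y = f x y.
Proof.
move=> linr linl.
pose fx x : {linear Y -> V} :=
  HB.pack (f x) (GRing.isLinear.Build _ _ _ _ _ (linr x)).
have linf: linear (fun x => linfun (fx x)).
  move=> k u v; apply/lfunP=> w.
  by rewrite add_lfunE scale_lfunE !lfunE /= linl.
pose g : {linear X -> 'Hom(Y, V)} :=
  HB.pack (fun x => linfun (fx x)) (GRing.isLinear.Build _ _ _ _ _ linf).
by exists (linfun g) => x y; rewrite !lfunE.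
Qed.

Lemma transpose_lfun (X Y V : vectType F) (b : 'Hom(X, 'Hom(Y, V))) :
  exists b' : 'Hom(Y, 'Hom(X, V)), forall x y, b' y x = b x y.
Proof.
have [||b' def_b'] := @bilinear_lfun Y X V (fun y x => b x y).
- by move=> y k u v; rewrite linearP /= add_lfunE scale_lfunE.
- by move=> x k u v; rewrite linearP.
by exists b'.
Qed.

Lemma segre_transpose (X Y V : vectType F) (b : 'Hom(X, 'Hom(Y, V)))
    (b' : 'Hom(Y, 'Hom(X, V))) :
  (forall x y, b' y x = b x y) -> segre b -> segre b'.
Proof.
move=> def_b' segb y x y' x'; rewrite !def_b' => eqb nzy nzx.
have [c def_x' def_y] := segb _ _ _ _ eqb nzx nzy.
have nzc: c != 0 by apply: contraNneq nzy => c0; rewrite def_y c0 scale0r.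
by exists c^-1; rewrite ?def_y ?def_x' scalerA mulVf // scale1r.
Qed.

Lemma segre_inj (X Y V : vectType F) (b : 'Hom(X, 'Hom(Y, V))) x :
  segre b -> x != 0 -> lker (b x) = 0%VS.
Proof.
move=> segb nzx; apply/eqP; rewrite -subv0; apply/subvP=> y.
rewrite memv_ker memv0; apply: contraLR => nzy; apply/eqP=> bxy0.
have [|c /esym/eqP] := segb x y 0 y _ nzx nzy.
  by rewrite bxy0 linear0 zero_lfunE.
rewrite scaler_eq0 (negPf nzx) orbF => /eqP->; rewrite scale0r => y0.
by rewrite y0 eqxx in nzy.
Qed.

Lemma subspace_of_dim (V : vectType F) (A : {vspace V}) d :
  (d <= \dim A)%N -> exists2 B : {vspace V}, (B <= A)%VS & \dim B = d.
Proof.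
move=> le_d; exists <<take d (vbasis A)>>%VS.
  by apply/span_subvP=> v /mem_take; apply: vbasis_mem.
have: free (take d (vbasis A) ++ drop d (vbasis A)).
  by rewrite cat_take_drop (basis_free (vbasisP A)).
move/catl_free/eqP->; rewrite size_take size_tuple.
by case: ltngtP le_d.
Qed.

Definition vectors (V : vectType F) : seq V := enum (finvect_type V).

Lemma mem_vectors (V : vectType F) (v : V) : v \in vectors V.
Proof. exact: (mem_enum (finvect_type V)). Qed.

Definition rows (X Y V : vectType F) (b : 'Hom(X, 'Hom(Y, V)))
    (A A' : {vspace X}) (B : {vspace Y}) : seq {vspace V} :=
  [seq (b x @: B)%VS | x <- vectors X & (x \in A) && (x \notin A')].

Lemma rowsP (X Y V : vectType F) (b : 'Hom(X, 'Hom(Y, V)))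
    (A A' : {vspace X}) (B : {vspace Y}) U :
  reflect (exists x, [/\ x \in A, x \notin A' & U = (b x @: B)%VS])
          (U \in rows b A A' B).
Proof.
apply: (iffP mapP) => [[x]|[x [Ax A'x ->]]].
  by rewrite mem_filter => /andP[/andP[Ax A'x] _] ->; exists x.
by exists x; rewrite // mem_filter Ax A'x mem_vectors.
Qed.

Lemma dim_rows (X Y V : vectType F) (b : 'Hom(X, 'Hom(Y, V)))
    (A A' : {vspace X}) (B : {vspace Y}) U :
  segre b -> U \in rows b A A' B -> \dim U = \dim B.
Proof.
move=> segb /rowsP[x [_ A'x ->]]; apply: limg_dim_eq.
by rewrite segre_inj ?capv0 //; apply: contraNneq A'x => ->; apply: mem0v.
Qed.

(** If the rows of x and x' share a nonzero vector then x' is a multiple of x,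
    so the rows coincide. *)
Lemma tiles_rows (X Y V : vectType F) (b : 'Hom(X, 'Hom(Y, V)))
    (A A' : {vspace X}) (B : {vspace Y}) :
  segre b -> (0 < \dim B)%N ->
  tiles (fun v => exists x y, [/\ x \in A, x \notin A', y \in B & v = b x y])
        (rows b A A' B).
Proof.
move=> segb B_gt0; split.
- by move=> U /(dim_rows segb) dimU; rewrite -dimv_eq0 dimU -lt0n.
- move=> v; split=> [[x [y [Ax A'x By ->]]] | [U /rowsP[x [Ax A'x ->]]]].
    by exists (b x @: B)%VS; rewrite ?memv_img //; apply/rowsP; exists x.
  by case/memv_imgP=> y By ->; exists x, y.
move=> v U W nzv /rowsP[x [Ax A'x ->]] /rowsP[x' [Ax' A'x' ->]].
case/memv_imgP=> y By def_v /memv_imgP[y' By'].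
rewrite def_v => eqb; rewrite {v}def_v in nzv.
have nzx: x != 0 by apply: contraNneq A'x => ->; apply: mem0v.
have nzx': x' != 0 by apply: contraNneq A'x' => ->; apply: mem0v.
have nzy: y != 0 by apply: contraNneq nzv => ->; rewrite linear0.
have [c def_x' _] := segb _ _ _ _ eqb nzx nzy.
have nzc: c != 0 by apply: contraNneq nzx' => c0; rewrite def_x' c0 scale0r.
apply/vspaceP=> w; apply/memv_imgP/memv_imgP=> -[z Bz ->].
  exists (c^-1 *: z); rewrite ?memvZ // def_x' !linearZ /= scale_lfunE.
  by rewrite scalerA mulVf ?scale1r.
by exists (c *: z); rewrite ?memvZ // def_x' !linearZ /= scale_lfunE.
Qed.

Lemma notin_subspace (X : vectType F) (A A' : {vspace X}) :
  (\dim A' < \dim A)%N -> exists2 x, x \in A & x \notin A'.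
Proof.
move=> ltA'; apply/subvPn; apply: contraL ltA' => /dimvS.
by rewrite -leqNgt.
Qed.

Lemma map_dim_rows (X Y V : vectType F) (b : 'Hom(X, 'Hom(Y, V)))
    (A A' : {vspace X}) (B : {vspace Y}) :
  segre b -> (\dim A' < \dim A)%N ->
  map (dimv (vT := V)) (rows b A A' B) =i [:: \dim B].
Proof.
move=> segb ltA' d; rewrite inE; apply/mapP/eqP => [[U /(dim_rows segb) -> //]|->].
have [x Ax A'x] := notin_subspace ltA'.
have rx : (b x @: B)%VS \in rows b A A' B by apply/rowsP; exists x.
by exists (b x @: B)%VS; rewrite ?(dim_rows segb rx).
Qed.

(** The step of the induction keeps the rows outside a subspace A' of A and
    transposes what is left: the recursive call tiles the rectangle B x A' of
    the transposed pairing, whose rows are the columns of b.  This is why the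
    entries of s are bounded by the dimension of A as well, and why X, Y and b
    vary in the induction. *)
Lemma rectangle_tiling (s : seq nat) : forall (X Y V : vectType F)
    (b : 'Hom(X, 'Hom(Y, V))) (A : {vspace X}) (B : {vspace Y}),
  segre b -> sorted gtn (\dim B :: s) -> all (leq 1) (\dim B :: s) ->
  all (gtn (\dim A)) (0%N :: s) ->
  exists2 P, tiles (rectangle b A B) P & map (dimv (vT := V)) P =i \dim B :: s.
Proof.
elim: s => [|d s IHs] X Y V b A B segb sort_s /andP[B_gt0 pos_s];
  move=> /= /andP[A_gt0 lt_sA].
  exists (rows b A 0 B); last by apply: map_dim_rows; rewrite ?dimv0.
  have [nz cov dis] := tiles_rows A 0 segb B_gt0; split=> // v.
  rewrite -cov; split=> [[x [y [Ax By ->]]] | [x [y [Ax _ By ->]]]].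
    2: by exists x, y.
  have [->|nzx] := eqVneq x 0; last by exists x, y; rewrite memv0.
  (* The zero vector lies in every row, and there is one as A is not zero. *)
  exists (vpick A), 0; rewrite memv_pick memv0 vpick0 mem0v !linear0 zero_lfunE.
  by rewrite -dimv_eq0 -lt0n.
have /andP[lt_dA {}lt_sA] := lt_sA.
have [A' sA'A dimA'] := subspace_of_dim (ltnW lt_dA).
have lt_sB: all (gtn (\dim B)) (0%N :: d :: s).
  rewrite /= B_gt0; apply: order_path_min sort_s => i j k /= ltij ltki.
  exact: ltn_trans ltki ltij.
have /andP[B_gt0' /andP[_ lt_sB']] := lt_sB.
have [b' def_b'] := transpose_lfun b.
have [|||P2 tile2 dim2] := IHs _ _ _ b' B A' (segre_transpose def_b' segb).
- by rewrite dimA'; case/andP: sort_s.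
- by rewrite dimA'.
- by rewrite /= B_gt0.
exists (rows b A A' B ++ P2).
  apply: (tiles_cat (tiles_rows A A' segb B_gt0) tile2) => [v|v].
    split=> [[x [y [Ax By ->]]]|].
      by case: (boolP (x \in A')) => A'x; [right; exists y, x | left; exists x, y];
        rewrite ?def_b'.
    case=> [[x [y [Ax _ By ->]]]|[y [x [By A'x ->]]]]; exists x, y => //.
    by rewrite def_b' (subvP sA'A).
  case=> x [y [Ax A'x By ->]] [y' [x' [_ A'x' /eqP]]]; rewrite def_b' => /eqP eqb.
  apply/eqP; apply: contraNT A'x => nzb.
  have nzx: x != 0 by apply: contraNneq nzb => ->; rewrite linear0 zero_lfunE.
  have nzy: y != 0 by apply: contraNneq nzb => ->; rewrite linear0.
  have [c def_x' def_y] := segb _ _ _ _ eqb nzx nzy.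
  have nzc: c != 0 by apply: contraNneq nzy => c0; rewrite def_y c0 scale0r.
  by rewrite -(scalerK nzc x) -def_x' memvZ.
move=> e; rewrite map_cat mem_cat dim2 (map_dim_rows _ segb) ?dimA' //.
by rewrite !inE.
Qed.

End Segre.

(** * The extension of degree n and its Frobenius map *)

Lemma frobenius_lfun (F : finFieldType) (L : splittingFieldType F) :
  exists phi : 'End(L), forall x, phi x = x ^+ #|F|.
Proof.
have [a _ Da] := finField_galois_generator (sub1v {:L}).
by exists (gal_repr a) => x; rewrite Da ?memvf // dimv1 expn1.
Qed.

(** The splitting field L of X^m - X, with m = #|F| ^ n: the roots are the fixed
    points of the n-th power of the Frobenius automorphism, hence a subfield,
    hence all of L; and there are m of them since the derivative of X^m - X is
    -1. *)
Lemma finField_extension (F : finFieldType) (n : nat) :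
  (0 < n)%N -> exists L : splittingFieldType F, \dim {:L} = n.
Proof.
move=> n_gt0; pose m := (#|F| ^ n)%N.
have m_gt1: (1 < m)%N by rewrite (ltn_exp2l 0) ?finNzRing_gt1.
pose q (R : nzRingType) : {poly R} := 'X^m - 'X.
have size_q R : size (q R) = m.+1.
  by rewrite size_polyDl size_polyXn // size_polyN size_polyX.
have /FinSplittingFieldFor[L]: q F != 0 by rewrite -size_poly_gt0 size_q.
rewrite [map_poly _ _]rmorphB rmorphXn /= map_polyX -/(q L) => -[zs Dq defL].
exists L.
have card0 : (#|F|)%:R = 0 :> L.
  rewrite -(rmorph_nat (in_alg L)) (_ : #|F|%:R = 0) ?rmorph0 //.
  by have := expg_cardG (in_setT (1 : F)); rewrite FinRing.zmodXgE cardsT.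
have Uzs: uniq zs.
  rewrite -separable_prod_XsubC -(eqp_separable Dq) separable_poly.unlock.
  rewrite derivB derivXn derivX -mulr_natl -polyC_natr natrX card0.
  rewrite expr0n gtn_eqF // mul0r sub0r -scaleN1r.
  by rewrite coprimepZr ?coprimep1 // oppr_eq0 oner_eq0.
have [a _ Da] := finField_galois_generator (sub1v {:L}).
pose E := fixedSpace (a ^+ n)%g.
have in_zs: zs =i E.
  move=> z; rewrite -root_prod_XsubC -(eqp_root Dq) (sameP fixedSpaceP eqP).
  rewrite rootE !hornerE subr_eq0 /m; congr (_ == z).
  elim: (n) => [|i IHi]; first by rewrite gal_id.
  by rewrite expgSr expnSr exprM IHi galM ?Da ?memvf // dimv1 expn1.
have defE: E = {:L}%VS.
  apply/eqP; rewrite eqEsubv subvf -defL -[E]subfield_closed agenvS //.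
  by rewrite subv_add sub1v; apply/span_subvP=> z; rewrite in_zs.
(* A copy of L carrying the finite type structure that cardinals require. *)
pose Lf := finvect_type L.
have cardL : (#|F| ^ \dim {:L})%N = #|Lf|.
  by rewrite -(@card_vspace F Lf _ fullv) card_vspacef.
have cardm : #|Lf| = m.
  apply: succn_inj; rewrite -(size_q L) (eqp_size Dq) size_prod_XsubC; congr _.+1.
  have /card_uniqP<- : uniq (zs : seq Lf) := Uzs.
  apply: eq_card => z.
  by rewrite [RHS](_ : _ = (z \in E)) ?in_zs // defE memvf.
by apply/eqP; rewrite -(eqn_exp2l _ _ (finNzRing_gt1 F)) cardL cardm.
Qed.

(** * Transport along an isomorphism *)

Lemma iso_lfun (F : fieldType) (W V : vectType F) :
  \dim {:W} = \dim {:V} ->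
  exists2 f : 'Hom(W, V), lker f == 0%VS & limg f = fullv.
Proof.
move=> eqdim.
have [f def_f] := linear_of_free (vbasis {:W}) (vbasis {:V}).
have imf: limg (linfun f) = fullv.
  rewrite -[X in (_ @: X)%VS](span_basis (vbasisP _)) limg_span.
  rewrite (eq_map (lfunE f)) def_f ?(basis_free (vbasisP _)) ?size_tuple //.
  exact: span_basis (vbasisP _).
exists (linfun f) => //; rewrite -dimv_eq0 -(eqn_add2r (\dim {:V})) add0n.
by rewrite -{1}imf -eqdim -(limg_ker_dim (linfun f) fullv) capfv.
Qed.

Lemma T_partition_iso (F : finFieldType) (W V : vectType F) (T : seq nat)
    (f : 'Hom(W, V)) (P : seq {vspace W}) :
  lker f == 0%VS -> limg f = fullv -> T_partition T P ->
  T_partition T [seq (f @: U)%VS | U <- P].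
Proof.
move=> kerf imf [[uP nzP covP disP] dimP].
have injf : injective (lfun_img f).
  by move=> U1 U2 /eqP; rewrite eq_limg_ker0 // => /eqP.
have dimf U : \dim (f @: U) = \dim U.
  by rewrite limg_dim_eq // (eqP kerf) capv0.
split; last first.
  by move=> d; rewrite -dimP -map_comp (@eq_map _ _ _ (dimv (vT := W)) dimf).
split.
- by rewrite map_inj_uniq.
- move=> _ /mapP[U PU ->] fU0; apply: (nzP U PU); apply: injf.
  by rewrite fU0 limg0.
- move=> v; have /memv_imgP[w _ ->] : v \in limg f by rewrite imf memvf.
  by have [U PU Uw] := covP w; exists (f @: U)%VS; rewrite ?map_f ?memv_img.
move=> _ _ /mapP[U PU ->] /mapP[U' PU' ->] neq.
by rewrite -lker0_img_cap // disP ?limg0 // => eqU; apply: neq; rewrite eqU.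
Qed.

(** * Partitions of L * L *)

Section Square.

Variables (F : finFieldType) (L : splittingFieldType F).
Local Notation W := (L * L)%type.

(** If c u = c' u' and c u^q = c' u'^q, then r = u' / u = c / c' satisfies
    r^q = r, so it is in F. *)
Lemma frobenius_segre :
  exists b : 'Hom(L, 'Hom(L, W)),
    segre b /\ forall u c, b u c = (c * u, c * u ^+ #|F|).
Proof.
have [phi Dphi] := frobenius_lfun L.
have [||b Db] := @bilinear_lfun F L L W (fun u c => (c * u, c * phi u)).
- by move=> u k c d; rewrite !mulrDl -!scalerAl.
- by move=> c k u v; rewrite linearP !mulrDr -!scalerAr.
exists b; split=> [u c u' c'|u c]; last by rewrite Db Dphi.
rewrite !Db !Dphi => -[eq1 eq2] nzu nzc.
have nzc': c' != 0.
  by apply: contraNneq nzc => c'0; rewrite c'0 mul0r in eq1; move/eqP: eq1;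
    rewrite mulf_eq0 (negPf nzu) orbF.
pose r := c / c'.
have Dc : c = r * c' by rewrite divfK.
have Du' : u' = r * u by apply: (mulfI nzc'); rewrite -eq1 Dc mulrCA mulrA.
have : r \in 1%VS.
  rewrite Fermat's_little_theorem dimv1 expn1; apply/eqP.
  have nzuq : c' * u ^+ #|F| != 0 by rewrite mulf_neq0 ?expf_neq0.
  by apply: (mulIf nzuq); rewrite mulrCA -exprMn -Du' -eq2 Dc mulrA.
by case/vlineP=> k Dr; exists k; [rewrite Du' | rewrite Dc]; rewrite Dr mulr_algl.
Qed.

Lemma square_tiling (n : nat) (s : seq nat) :
  \dim {:L} = n -> (0 < n)%N -> sorted gtn (n :: s) -> all (leq 1) s ->
  exists P : seq {vspace W}, T_partition (n :: s) P.
Proof.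
move=> dimL n_gt0 sort_s pos_s.
have [b [segb Db]] := frobenius_segre.
have [||| P [nzP covP disP] dimP] :=
  @rectangle_tiling F s L L W b fullv fullv segb.
- by rewrite dimL.
- by rewrite dimL /= n_gt0.
- rewrite dimL /= n_gt0.
  by apply: order_path_min sort_s => i j h /= ltij lthi; apply: ltn_trans ltij.
(* The L-scaling of L * L as a pairing: k v is onto the L-line through v. *)
have [||k Dk] := @bilinear_lfun F W L W (fun v c => (c * v.1, c * v.2)).
- by move=> v i c d; rewrite !mulrDl -!scalerAl.
- by move=> c i u v; rewrite !mulrDr -!scalerAr.
pose inP v := has (fun U : {vspace W} => v \in U) P.
have inPP v : reflect (exists u c, v = b u c) (inP v).
  apply: (iffP hasP) => [/covP[u [c [_ _ ->]]]|[u [c ->]]]; first by exists u, c.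
  by apply/covP; exists u, c; rewrite !memvf.
have inPk v c : c != 0 -> inP (k v c) = inP v.
  have sub d w : inP w -> inP (k w d).
    case/inPP=> u [e ->]; apply/inPP; exists u, (d * e).
    by rewrite Dk !Db !mulrA.
  move=> nzc; apply/idP/idP=> [/(sub c^-1)|/(sub c)//].
  by rewrite !Dk /= !mulrA mulVf // !mul1r; case: (v).
have inP0 : inP 0 by apply/inPP; exists 0, 0; rewrite !linear0.
have kerk v : v != 0 -> lker (k v) == 0%VS.
  move=> nzv; rewrite -subv0; apply/subvP=> c; rewrite memv_ker memv0 Dk.
  apply: contraLR => nzc; apply: contra nzv => /eqP[/eqP e1 /eqP e2].
  move: e1 e2; rewrite !mulf_eq0 (negPf nzc) /=.
  by case: (v) => v1 v2 /= /eqP-> /eqP->.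
(* The L-lines that avoid the values of b. *)
pose Q := [seq (k v @: fullv)%VS | v <- vectors W & ~~ inP v].
have QP U : reflect (exists2 v, ~~ inP v & U = (k v @: fullv)%VS) (U \in Q).
  apply: (iffP mapP) => [[v]|[v nPv ->]].
    by rewrite mem_filter => /andP[]; exists v.
  by exists v; rewrite // mem_filter nPv mem_vectors.
have nz v : ~~ inP v -> v != 0 by apply: contraNneq => ->.
have dimQ U : U \in Q -> \dim U = n.
  by case/QP=> v /nz/kerk kv0 ->; rewrite limg_dim_eq // (eqP kv0) capv0.
have tileQ : tiles (fun w => exists v c, ~~ inP v /\ w = k v c) Q.
  split=> [U /dimQ dimU | w | w U1 U2 nzw].
  - by rewrite -dimv_eq0 dimU -lt0n.
  - split=> [[v [c [nPv ->]]]|[_ /QP[v nPv ->] /memv_imgP[c _ ->]]].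
    2: by exists v, c.
    by exists (k v @: fullv)%VS; rewrite ?memv_img ?memvf //; apply/QP; exists v.
  have line v : w \in (k v @: fullv)%VS -> (k v @: fullv = k w @: fullv)%VS.
    case/memv_imgP=> c _ Dw.
    have nzc : c != 0 by apply: contraNneq nzw => c0; rewrite Dw c0 linear0.
    apply/vspaceP=> x; apply/memv_imgP/memv_imgP=> -[d _ ->].
      by exists (d / c); rewrite ?memvf // Dw !Dk /= !mulrA divfK.
    by exists (d * c); rewrite ?memvf // Dw !Dk /= !mulrA.
  by case/QP=> v1 _ -> /QP[v2 _ ->] /line-> /line->.
have tileP : tiles inP P.
  split=> // v; rewrite -covP; split=> [/inPP[u [c ->]]|[u [c [_ _ ->]]]].
    by exists u, c; rewrite !memvf.
  by apply/inPP; exists u, c.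
exists (undup (P ++ Q)); split.
  apply/tiles_undup/(tiles_cat tileP tileQ) => v.
    split=> // _; case: (boolP (inP v)) => [|nPv]; [by left | right].
    by exists v, 1; split=> //; rewrite Dk !mul1r; case: (v).
  move=> Pv [v0 [c [nPv0 Dv]]]; have [c0|/inPk e] := eqVneq c 0.
    by rewrite Dv c0 linear0.
  by rewrite Dv e (negPf nPv0) in Pv.
move=> d; rewrite (eq_mem_map _ (mem_undup _)) map_cat mem_cat dimP dimL.
apply/orb_idr => /mapP[U /dimQ -> ->]; exact: mem_head.
Qed.

End Square.

Local Close Scope ring_scope.

Theorem proposition4p1 (q : nat) (hq : prime_power q)
    (F : finFieldType) (hF : #|F| = q)
    (T : seq nat) (hT0 : T <> [::])
    (hTpos : forall n : nat, n \in T -> 0 < n)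
    (hTlt : sorted ltn T)
    (V : vectType F) (hV : \dim {:V} = 2 * last 0 T) :
  exists P : seq {vspace V}, T_partition T P.
Proof.
case/lastP: T hT0 hTpos hTlt hV => [//|T n] _ posT ltT.
rewrite last_rcons => dimV.
have n_gt0 : (0 < n)%N by apply: posT; rewrite mem_rcons mem_head.
have [L dimL] := finField_extension F n_gt0.
have [||P partP] := @square_tiling F L n (rev T) dimL n_gt0.
- by rewrite -rev_rcons rev_sorted.
- apply/allP=> d; rewrite mem_rev => Td; apply: posT.
  by rewrite mem_rcons inE Td orbT.
have [|f kerf imf] := @iso_lfun F (L * L)%type V.
  by rewrite dimV -dimL !dimvf mul2n -addnn.
exists [seq (f @: U)%VS | U <- P].
have [partV dimsV] := T_partition_iso kerf imf partP.
by split=> // d; rewrite dimsV -rev_rcons mem_rev.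
Qed.
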